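(* Let $n$ be a positive integer. Then $$r_1(D_{2n})=\begin{cases}\operatorname{Cyc}(D_{2n}) & \text{if } n=2k+1 \text{ is odd},\\ \operatorname{Cyc}(D_{2n})+k & \text{if } n=2k \text{ is even},\end{cases}\qquad\text{and}\qquad r_1(Dic_n)=\operatorname{Cyc}(Dic_n),$$ where $\operatorname{Cyc}(D_{2n})=n+\tau(n)$.
   Context: $D_{2n}=\langle a,b \mid a^n=b^2=1,\ bab^{-1}=a^{-1}\rangle$ is the dihedral group of order $2n$, and $Dic_n=\langle a,x\mid a^{2n}=1,\ x^2=a^n,\ xax^{-1}=a^{-1}\rangle$ is the dicyclic group of order $4n$. $\operatorname{Cyc}(G)$ denotes the number of cyclic subgroups of a finite group $G$ (including the trivial subgroup), and $\tau(n)$ denotes the number of positive divisors of $n$. For a finite group $G$, let $G(1)=\{(g,k)\in G\times G : [k,g]=1\}$ be the set of commuting pairs. Consider the graph with vertex set $G(1)$ whose edges are given by the identifications $(g,k)\sim(g,kg^m)$ for $m\in\mathbb{Z}$, and $(g,k)\sim(gkg^{-1},g^{-1})=(k,g^{-1})$. The number $r_1(G)$ is the number of connected components of this graph. *)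

(* Defs.v *)
From mathcomp Require Import all_boot all_fingroup cyclic.

Set Implicit Arguments.
Unset Strict Implicit.
Unset Printing Implicit Defensive.

Local Open Scope group_scope.

Definition Cyc (gT : finGroupType) (G : {group gT}) : nat :=
  #|[set C : {group gT} | (C \subset G) && cyclic C]|.

Definition tau (n : nat) : nat := size (divisors n).

Definition commuting_pairs (gT : finGroupType) (G : {group gT}) :
    {set gT * gT} :=
  [set u | [&& u.1 \in G, u.2 \in G & [~ u.2, u.1] == 1]].

(* With u = (g, k), the left coset k *: <[g]> is {k g^m : m in Z}.  The
   conjugate g k g^-1 is written out because MathComp's k ^ g is g^-1 k g. *)
Definition identified (gT : finGroupType) : rel (gT * gT) :=
  fun u v =>
    [|| (v.1 == u.1) && (v.2 \in u.2 *: <[u.1]>)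
      | v == (u.1 * u.2 * u.1^-1, u.1^-1)].

(* n_comp counts connected components only for symmetric relations, whence the
   symmetrisation. *)
Definition r1_edge (gT : finGroupType) (G : {group gT}) : rel (gT * gT) :=
  [rel u v in commuting_pairs G | identified u v || identified v u].

Definition r1_number (gT : finGroupType) (G : {group gT}) : nat :=
  n_comp (r1_edge G) (commuting_pairs G).

(* Main.v *)
(* On commuting pairs the two identifications generate the action of SL_2(Z),
   which preserves the subgroup <g, k>.  If <g, k> is cyclic, Euclid's algorithm
   on exponents brings (g, k) to (c, 1) for any chosen generator c, so r_1(G) is
   Cyc(G) plus the number of components of pairs generating a noncyclic group.

   In D_{2n} and Dic_n every element outside <a> inverts <a> and has the same
   square, so a commuting pair not inside <a> generates <y, w> with y outside
   <a> and w in <a>, w^2 = 1.  In Dic_n, w is a power of y^2 = a^n, and in D_{2n}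
   with n odd, w = 1: everything is cyclic.  In D_{2n} with n = 2k, the noncyclic
   groups are the k Klein groups <y, a^k>, each forming one component. *)

Require Import Defs.
From mathcomp Require Import all_boot all_fingroup cyclic ssralg finalg zmodp.

Set Implicit Arguments.
Unset Strict Implicit.
Unset Printing Implicit Defensive.

Local Open Scope group_scope.

(** * Components and generated subgroups *)

(** [f] is a complete invariant of components, hence injective on roots; closedness of [A] keeps the
    root of each point inside [A]. *)
Lemma n_comp_imset (T rT : finType) (e : rel T) (A : {set T}) (f : T -> rT) :
    connect_sym e -> closed e A ->
    {in A &, forall u v, connect e u v = (f u == f v)} ->
  n_comp e A = #|f @: A|.
Proof.
move=> sym_e clA conn_f; pose B := [set u in A | roots e u].
have ->: n_comp e A = #|B|.
  by apply: eq_card => u; rewrite !inE andbC.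
have <-: f @: B = f @: A.
  apply/eqP; rewrite eqEsubset imsetS /=; last by apply/subsetP=> u /setIdP[].
  apply/subsetP=> _ /imsetP[u Au ->].
  have Ar: root e u \in A by rewrite -(closed_connect clA (connect_root e u)).
  have /eqP->: f u == f (root e u) by rewrite -conn_f ?connect_root.
  by apply: imset_f; rewrite inE Ar roots_root.
symmetry; apply: card_in_imset => u v /setIdP[Au /eqP ru] /setIdP[Av /eqP rv].
by move/eqP; rewrite -conn_f // -root_connect // ru rv => /eqP.
Qed.

Section Components.

Variables (gT : finGroupType) (G : {group gT}).
Implicit Types (u v : gT * gT) (g k c : gT).

Definition pair_gen u : {group gT} := <<[set u.1; u.2]>>%G.

Lemma commuting_pairsP u :
  reflect [/\ u.1 \in G, u.2 \in G & commute u.1 u.2]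
          (u \in commuting_pairs G).
Proof.
rewrite inE; apply: (iffP and3P) => [[-> ->]|[-> ->]].
  by move/commgP/commute_sym.
by move/commute_sym/commgP.
Qed.

Lemma pair_gen_sub u (H : {group gT}) :
  (pair_gen u \subset H) = (u.1 \in H) && (u.2 \in H).
Proof. by rewrite gen_subG subUset !sub1set. Qed.

Lemma mem_pair_gen u : (u.1 \in pair_gen u) && (u.2 \in pair_gen u).
Proof. by rewrite -pair_gen_sub. Qed.

Lemma pair_genS u v :
    u.1 \in pair_gen v -> u.2 \in pair_gen v ->
    v.1 \in pair_gen u -> v.2 \in pair_gen u ->
  pair_gen u = pair_gen v.
Proof.
move=> u1 u2 v1 v2; apply/val_inj/eqP.
by rewrite eqEsubset !pair_gen_sub u1 u2 v1 v2.
Qed.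

Lemma pair_gen_cyclic g k c :
  g \in <[c]> -> k \in <[c]> -> cyclic (pair_gen (g, k)).
Proof.
by move=> gc kc; apply: cyclicS (cycle_cyclic c); rewrite pair_gen_sub gc.
Qed.

(** Each move can be undone inside the generated subgroup; commutation turns the conjugate
    [g * k * g^-1] into [k]. *)
Lemma identified_pair_gen u v :
  u \in commuting_pairs G -> identified u v -> pair_gen u = pair_gen v.
Proof.
case: u v => g k [g' k'] /commuting_pairsP[_ _ /= cgk] /orP[] /=.
  case/andP=> /eqP-> /lcosetP[_ /cycleP[m ->] ->].
  have /andP[/= ug uk] := mem_pair_gen (g, k).
  have /andP[/= vg vk] := mem_pair_gen (g, k * g ^+ m).
  apply: pair_genS => //=; first by rewrite -(groupMr _ (groupX m vg)).
  by rewrite groupM ?groupX.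
rewrite cgk mulgK => /eqP[-> ->].
have /andP[/= ug uk] := mem_pair_gen (g, k).
have /andP[/= vk vg] := mem_pair_gen (k, g^-1).
by apply: pair_genS => //=; rewrite -?(groupV _ g) // groupV.
Qed.

Lemma r1_edge_sym : symmetric (r1_edge G).
Proof. by move=> u v; rewrite /r1_edge /= orbC [X in X && _]andbC. Qed.

Lemma r1_connect_sym : connect_sym (r1_edge G).
Proof. exact/sym_connect_sym/r1_edge_sym. Qed.

Lemma r1_edge_pair_gen u v : r1_edge G u v -> pair_gen u = pair_gen v.
Proof.
case/andP=> /andP[Pu Pv] /orP[] /identified_pair_gen; first exact.
by move=> ->.
Qed.

Lemma connect_pair_gen u v :
  connect (r1_edge G) u v -> pair_gen u = pair_gen v.
Proof.
case/connectP=> p + ->; elim: p u => //= w p IHp u /andP[/r1_edge_pair_gen->].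
exact: IHp.
Qed.

Lemma commuting_pairs_closed : closed (r1_edge G) (commuting_pairs G).
Proof. by move=> u v /andP[/andP[-> ->]]. Qed.

Lemma connect_commuting u v :
  connect (r1_edge G) u v ->
  (u \in commuting_pairs G) = (v \in commuting_pairs G).
Proof. exact: (closed_connect commuting_pairs_closed). Qed.

Lemma connect_shear g k c :
    (g, k) \in commuting_pairs G -> c \in <[g]> ->
  connect (r1_edge G) (g, k) (g, k * c).
Proof.
move=> Pu gc; have /commuting_pairsP[/= Gg Gk cgk] := Pu.
apply: connect1; rewrite /r1_edge /= Pu /identified /= eqxx mem_lcoset mulKg gc /= andbT.
have /cycleP[m ->] := gc.
apply/commuting_pairsP; split; rewrite ?groupM ?groupX //=.
by apply: commuteM => //; apply: commuteX.
Qed.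

Lemma connect_rotate g k :
  (g, k) \in commuting_pairs G -> connect (r1_edge G) (g, k) (k, g^-1).
Proof.
move=> Pu; have /commuting_pairsP[/= Gg Gk cgk] := Pu.
apply: connect1; rewrite /r1_edge /= Pu /identified /= cgk mulgK eqxx !orbT /= andbT.
apply/commuting_pairsP; split; rewrite ?groupV //=.
exact/commuteV/commute_sym.
Qed.

(* Euclid's algorithm on the exponents. *)
Lemma connect_euclid c i j :
    (c ^+ i, c ^+ j) \in commuting_pairs G ->
  exists h, connect (r1_edge G) (c ^+ i, c ^+ j) (1, h).
Proof.
elim/ltn_ind: i j => i IHi j; case: (posnP i) => [->|i_gt0] Pij.
  by exists (c ^+ j); rewrite expg0.
have := connect_shear Pij (groupX (j %/ i) (groupVr (cycle_id (c ^+ i)))).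
rewrite {2}(divn_eq j i) addnC mulnC expgD expgM expVgn mulgK => conn1.
have P1: (c ^+ i, c ^+ (j %% i)) \in commuting_pairs G.
  by rewrite -(connect_commuting conn1).
have conn2 := connect_rotate P1.
(* The inverse left by the rotation becomes a natural power [c ^+ l]; the size of [l] is harmless,
   since the induction is on the first exponent only. *)
have /cycleP[l e_l]: (c ^+ i)^-1 \in <[c]> by rewrite groupV mem_cycle.
rewrite e_l in conn2.
have P2: (c ^+ (j %% i), c ^+ l) \in commuting_pairs G.
  by rewrite -(connect_commuting conn2).
have [|h conn3] := IHi _ _ _ P2; first exact: ltn_pmod.
by exists h; apply: connect_trans conn1 (connect_trans conn2 conn3).
Qed.

(** Euclid leads to [(1, h)] with [h] another generator of [<[c]>]; then [(1, h)], [(h, 1)],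
    [(h, c)], [(c, h^-1)], [(c, 1)] are successively connected. *)
Lemma connect_cyclic u c :
    u \in commuting_pairs G -> pair_gen u = <[c]> :> {set gT} ->
  connect (r1_edge G) u (c, 1).
Proof.
case: u => g k Pu gen_u; have /andP[/=] := mem_pair_gen (g, k).
rewrite gen_u => /cycleP[i e_g] /cycleP[j e_k].
have [h]: exists h, connect (r1_edge G) (g, k) (1, h).
  by rewrite e_g e_k; apply: connect_euclid; rewrite -e_g -e_k.
move=> conn_h; apply: connect_trans (conn_h) _.
have Ph: (1, h) \in commuting_pairs G by rewrite -(connect_commuting conn_h).
have gen_h: <[h]> = <[c]>.
  rewrite -gen_u (connect_pair_gen conn_h) /=.
  apply/eqP; rewrite eqEsubset cycle_subG gen_subG subUset !sub1set.
  rewrite group1 cycle_id andbT.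
  by rewrite mem_gen // !inE eqxx orbT.
have /= conn1 := connect_rotate Ph; rewrite invg1 in conn1.
have P1: (h, 1) \in commuting_pairs G by rewrite -(connect_commuting conn1).
have /= conn2 : connect (r1_edge G) (h, 1) (h, 1 * c).
  by apply: connect_shear => //; rewrite gen_h cycle_id.
rewrite mul1g in conn2.
have P2: (h, c) \in commuting_pairs G by rewrite -(connect_commuting conn2).
have conn3 := connect_rotate P2.
have P3: (c, h^-1) \in commuting_pairs G by rewrite -(connect_commuting conn3).
have := connect_shear P3; move/(_ h); rewrite mulVg -gen_h cycle_id => /(_ isT).
move=> conn4.
exact: connect_trans conn1 (connect_trans conn2 (connect_trans conn3 conn4)).
Qed.

(** The hypothesis makes [pair_gen] a complete invariant of components; every cyclic subgroup
    [<[c]>] of [G] is attained, by [(c, 1)]. *)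
Lemma r1_numberE :
    {in commuting_pairs G &, forall u v,
       pair_gen u = pair_gen v -> ~~ cyclic (pair_gen u) ->
       connect (r1_edge G) u v} ->
  r1_number G = Cyc G +
    #|[set pair_gen u | u in commuting_pairs G & ~~ cyclic (pair_gen u)]|.
Proof.
move=> conn_noncyc.
rewrite /r1_number (n_comp_imset (f := pair_gen) r1_connect_sym).
- rewrite -(cardsID [set C : {group gT} | cyclic C]); congr (_ + _).
    apply: eq_card => C; rewrite !inE; apply/andP/andP=> -[].
      case/imsetP=> u /commuting_pairsP[G1 G2 _] -> cycC.
      by rewrite pair_gen_sub G1 G2.
    move=> sCG cycC; split=> //; have [c def_C] := cyclicP cycC.
    have Gc: c \in G by rewrite (subsetP sCG) // def_C cycle_id.
    apply/imsetP; exists (c, 1).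
      apply/commuting_pairsP; split=> //=; exact: commute1.
    apply/val_inj/eqP; rewrite eqEsubset /= {1}def_C cycle_subG.
    case/andP: (mem_pair_gen (c, 1)) => /= -> _.
    by rewrite gen_subG subUset !sub1set group1 def_C cycle_id.
  apply: eq_card => C; rewrite !inE; apply/andP/imsetP.
    case=> ncycC /imsetP[u Pu def_C]; exists u => //.
    by rewrite inE Pu -def_C.
  case=> u /setIdP[Pu ncyc_u] ->; split=> //; exact: imset_f.
- exact: commuting_pairs_closed.
move=> u v Pu Pv; apply/idP/eqP=> [/connect_pair_gen //| eq_gen].
have [/cyclicP[c gen_u] | ncyc] := boolP (cyclic (pair_gen u)); last first.
  exact: conn_noncyc.
apply: connect_trans (connect_cyclic Pu gen_u) _; rewrite r1_connect_sym.
by apply: connect_cyclic => //; rewrite -eq_gen.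
Qed.

End Components.
Lemma order2_sqr (gT : finGroupType) (y : gT) :
  y ^+ 2 = 1 -> y != 1 -> #[y] = 2.
Proof. by move=> y2 y1; apply: nt_prime_order. Qed.

(** * Extensions of an inverted cyclic group *)

Section InvertedCycle.

Variables (gT : finGroupType) (G : {group gT}) (a x : gT).
Hypotheses (genG : <[a]> <*> <[x]> = G) (ax : a ^ x = a^-1).
Hypothesis xx : x ^+ 2 \in <[a]>.

Lemma conj_cycle_x c : c \in <[a]> -> c ^ x = c^-1.
Proof. by case/cycleP=> i ->; rewrite conjXg ax expgVn. Qed.

Lemma inverted_cycle_sub : <[a]> \subset G.
Proof. by rewrite -genG joing_subl. Qed.

Lemma inverted_cycle_memx : x \in G.
Proof. by rewrite -genG -cycle_subG joing_subr. Qed.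

(** [x] normalises [<[a]>], so the join is a product, and even powers of [x] fall into [<[a]>]. *)
Lemma inverted_cycleU : G = <[a]> :|: <[a]> :* x :> {set gT}.
Proof.
have Gx := inverted_cycle_memx.
apply/eqP; rewrite eqEsubset subUset inverted_cycle_sub /=; apply/andP; split.
  rewrite -genG norm_joinEr; last first.
    rewrite cycle_subG; apply/normP/eqP.
    rewrite eqEcard cardJg leqnn andbT; apply/subsetP=> _ /imsetP[c ca ->].
    by rewrite conj_cycle_x ?groupV.
  apply/subsetP=> _ /mulsgP[c _ ca /cycleP[i ->] ->].
  rewrite -(odd_double_half i) expgD -mul2n expgM inE.
  have Mxx: (x ^+ 2) ^+ i./2 \in <[a]> by rewrite groupX.
  case: (odd i); last by rewrite expg0 mul1g groupM.
  rewrite expg1 -expgM -expgS expgSr expgM.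
  by apply/orP; right; rewrite mulgA mem_rcoset mulgK groupM.
apply/subsetP=> _ /rcosetP[c ca ->].
by rewrite groupM // (subsetP inverted_cycle_sub).
Qed.

Hypothesis xNa : x \notin <[a]>.

Lemma setD_inverted_cycle : G :\: <[a]> = <[a]> :* x.
Proof.
apply/setP=> y; rewrite inverted_cycleU 2!inE mem_rcoset.
have [ya | //] := boolP (y \in <[a]>).
by rewrite groupMl // groupV (negbTE xNa).
Qed.

Lemma card_setD_inverted_cycle : #|G :\: <[a]>| = #[a].
Proof. by rewrite setD_inverted_cycle card_rcoset. Qed.

Lemma conj_cycle c y : c \in <[a]> -> y \in G :\: <[a]> -> c ^ y = c^-1.
Proof.
rewrite setD_inverted_cycle => ca /rcosetP[d da ->].
rewrite conjgM (_ : c ^ d = c) ?conj_cycle_x //.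
by apply/conjg_fixP/commgP; apply: (centsP (cycle_abelian a)).
Qed.

(** From [c * x = x * c^-1] one gets [(c * x) ^+ 2 = x * c^-1 * c * x]. *)
Lemma sqr_setD y : y \in G :\: <[a]> -> y ^+ 2 = x ^+ 2.
Proof.
rewrite setD_inverted_cycle => /rcosetP[c ca ->].
have e: c * x = x * c^-1 by rewrite -conj_cycle_x // -conjgC.
by rewrite expgS expg1 {1}e -mulgA mulKg.
Qed.

Lemma setD_divg y y' :
  y \in G :\: <[a]> -> y' \in G :\: <[a]> -> y' * y^-1 \in <[a]>.
Proof.
rewrite setD_inverted_cycle => /rcosetP[c ca ->] /rcosetP[d da ->].
by rewrite invMg mulgA mulgK groupM ?groupV.
Qed.

Lemma sqr_commute c y :
  c \in <[a]> -> y \in G :\: <[a]> -> commute c y -> c ^+ 2 = 1.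
Proof.
move=> ca Dy /commgP/conjg_fixP; rewrite conj_cycle // => e.
by rewrite expgS expg1 -{1}e mulVg.
Qed.

Lemma commuting_pair_setD u :
    u \in commuting_pairs G -> ~~ (pair_gen u \subset <[a]>) ->
  exists y w, [/\ y \in G :\: <[a]>, w \in <[a]>, w ^+ 2 = 1, commute w y
                & pair_gen u = pair_gen (y, w)].
Proof.
case: u => g k /commuting_pairsP[Gg Gk cgk]; rewrite pair_gen_sub.
move: Gg Gk cgk => /= Gg Gk cgk.
have [ga /= kNa | gNa _] := boolP (g \in <[a]>).
  have Dk: k \in G :\: <[a]> by rewrite inE kNa.
  exists k, g; split=> //; first exact: sqr_commute cgk.
  by apply/val_inj; rewrite /= setUC.
have Dg: g \in G :\: <[a]> by rewrite inE gNa.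
have [ka | kNa] := boolP (k \in <[a]>).
  by exists g, k; split=> //; apply: sqr_commute (commute_sym cgk).
have Dk: k \in G :\: <[a]> by rewrite inE kNa.
(* Two elements outside [<[a]>] lie in the same coset, so their quotient serves as [w]. *)
have wa := setD_divg Dg Dk.
have cwg: commute (k * g^-1) g.
  by apply/commute_sym/commuteM => //; apply: commuteV.
exists g, (k * g^-1); split=> //; first exact: sqr_commute cwg.
have /andP[/= ug uk] := mem_pair_gen (g, k).
have /andP[/= vg vk] := mem_pair_gen (g, k * g^-1).
apply: pair_genS => //=; last by rewrite groupM ?groupV.
by rewrite -(groupMr _ (groupVr vg)).
Qed.

(** A generator [y] outside [<[a]>] has [y ^+ 2 = x ^+ 2], so the other generator [w] is already a
    power of [y]. *)
Lemma cyclic_pair_gen u :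
    (forall w, w \in <[a]> -> w ^+ 2 = 1 -> w \in <[x ^+ 2]>) ->
    u \in commuting_pairs G -> cyclic (pair_gen u).
Proof.
move=> inv_x2 Pu; have [|] := boolP (pair_gen u \subset <[a]>).
  by move/cyclicS; apply; exact: cycle_cyclic.
case/(commuting_pair_setD Pu)=> y [w [Dy wa w2 _ ->]].
have wy: w \in <[y]>.
  by have := inv_x2 w wa w2; rewrite -(sqr_setD Dy); apply/subsetP/cycleX.
exact: (pair_gen_cyclic (cycle_id y) wy).
Qed.

Lemma r1_number_unique_involution :
    (forall w, w \in <[a]> -> w ^+ 2 = 1 -> w \in <[x ^+ 2]>) ->
  r1_number G = Cyc G.
Proof.
move=> inv_x2; rewrite r1_numberE => [|u v Pu _ _]; last first.
  by rewrite cyclic_pair_gen.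
rewrite (_ : [set _ | _ in _] = set0) ?cards0 ?addn0 //.
apply/eqP; rewrite -subset0; apply/subsetP=> C /imsetP[u /setIdP[Pu]].
by rewrite cyclic_pair_gen.
Qed.

End InvertedCycle.

(** * Klein four-groups, and the subgroups of a cyclic group *)

Lemma klein_mem (gT : finGroupType) (g k h : gT) :
    g ^+ 2 = 1 -> k ^+ 2 = 1 -> commute g k ->
  h \in pair_gen (g, k) -> [|| h == 1, h == g, h == k | h == g * k].
Proof.
move=> g2 k2 cgk; rewrite -[_ \in _]/(h \in <<[set g] :|: [set k]>>).
rewrite -joingE -joing_idl -joing_idr cent_joinEr; last first.
  by rewrite cycle_subG /= cent_cycle; apply/cent1P.
case/mulsgP=> _ _ /cycleP[i ->] /cycleP[j ->] ->.
rewrite -(expg_mod i g2) -(expg_mod j k2) !modn2.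
by case: (odd i) (odd j) => [] []; rewrite ?expg0 ?expg1 ?mul1g ?mulg1 eqxx ?orbT.
Qed.

(** Swaps and shears lead from [(g, k)] to all six ordered pairs of distinct involutions among [g],
    [k], [g * k]. *)
Lemma connect_klein (gT : finGroupType) (G : {group gT}) (u v : gT * gT) :
    u \in commuting_pairs G -> u.1 ^+ 2 = 1 -> u.2 ^+ 2 = 1 ->
    pair_gen u = pair_gen v -> ~~ cyclic (pair_gen u) ->
  connect (r1_edge G) u v.
Proof.
(* Since [p] is its own inverse, the rotation is a plain swap. *)
have swap p q : (p, q) \in commuting_pairs G -> p ^+ 2 = 1 ->
    connect (r1_edge G) (p, q) (q, p).
  move=> Ppq p2; rewrite -{2}(_ : p^-1 = p) ?connect_rotate //.
  by apply/eqP; rewrite eq_invg_mul -p2.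
have shear p q : (p, q) \in commuting_pairs G ->
    connect (r1_edge G) (p, q) (p, p * q).
  move=> Ppq; have /commuting_pairsP[_ _ /= ->] := Ppq.
  exact/connect_shear/cycle_id.
case: u v => g k [g' k'] Pu g2 k2 gen_uv ncyc; rewrite /= in g2 k2.
have /commuting_pairsP[/= Gg Gk cgk] := Pu.
have c_kg := swap _ _ Pu g2.
have c_gh := shear _ _ Pu.
have c_kh: connect (r1_edge G) (g, k) (k, g * k).
  rewrite cgk; apply: connect_trans (c_kg) (shear _ _ _).
  by rewrite -(connect_commuting c_kg).
have [Nc1 Nc2 Nc3]: [/\ g' != 1, k' != 1 & g' != k'].
  split; apply: contraNneq ncyc => e; rewrite gen_uv e.
  - exact: (pair_gen_cyclic (group1 _) (cycle_id k')).
  - exact: (pair_gen_cyclic (cycle_id g') (group1 _)).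
  exact: (pair_gen_cyclic (cycle_id k') (cycle_id k')).
have /andP[ug uk] := mem_pair_gen (g', k').
rewrite -gen_uv in ug uk.
move: {ug uk gen_uv} (klein_mem g2 k2 cgk ug) (klein_mem g2 k2 cgk uk) Nc1 Nc2 Nc3 => /=.
(* Only [(g * k, g)] and [(g * k, k)] survive the case analysis; each is the swap of a pair already
   reached. *)
case/or4P=> /eqP-> /or4P[] /eqP->; rewrite ?eqxx // => _ _ _.
  apply: (connect_trans c_gh); apply: swap => //.
  by rewrite -(connect_commuting c_gh).
apply: (connect_trans c_kh); apply: swap => //.
by rewrite -(connect_commuting c_kh).
Qed.

(** A subgroup of a cyclic group is determined by its order, and each divisor [d] of [#[a]] is the
    order of [<[a ^+ (#[a] %/ d)]>]. *)
Lemma card_cyclic_subgroups (gT : finGroupType) (a : gT) :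
  #|[set C : {group gT} | C \subset <[a]>]| = tau #[a].
Proof.
rewrite /tau cardE -(size_map (fun C : {group gT} => #|C|)); apply/perm_size.
have [uniq_div _ _] := divisors_correct (order_gt0 a).
apply: uniq_perm => // [|d].
  rewrite map_inj_in_uniq ?enum_uniq // => C C'.
  rewrite !mem_enum !inE => sCa sCa' /eqP eq_card.
  by apply/val_inj/eqP; rewrite /= (eq_subG_cyclic (cycle_cyclic a)).
rewrite -dvdn_divisors ?order_gt0 //; apply/mapP/idP => [[C]|dv_d].
  by rewrite mem_enum inE => /cardSg dv ->.
have := cycle_sub_group dv_d; move/setP/(_ <[a ^+ (#[a] %/ d)]>%G).
rewrite !inE eqxx => /andP[sCa /eqP <-].
by exists <[a ^+ (#[a] %/ d)]>%G; rewrite ?mem_enum ?inE.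
Qed.

(** * Dihedral groups *)

Section Dihedral.

Variables (gT : finGroupType) (G : {group gT}) (a x : gT).
Hypotheses (genG : <[a]> <*> <[x]> = G) (ax : a ^ x = a^-1).
Hypotheses (x2 : x ^+ 2 = 1) (xNa : x \notin <[a]>).

Let xx : x ^+ 2 \in <[a]>. Proof. by rewrite x2 group1. Qed.

Lemma reflection_order y : y \in G :\: <[a]> -> #[y] = 2.
Proof.
move=> Dy; apply: order2_sqr; first by rewrite (sqr_setD genG ax xx xNa Dy).
by apply: contraTneq Dy => ->; rewrite inE group1.
Qed.

(** The subgroups of [<[a]>] account for [tau #[a]]; any other cyclic subgroup is [{1, y}] for a
    unique reflection [y], and there are [#[a]] reflections. *)
Lemma Cyc_dihedral : Cyc G = (#[a] + tau #[a])%N.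
Proof.
rewrite /Cyc -(cardsID [set C : {group gT} | C \subset <[a]>]) addnC.
congr (_ + _)%N; last first.
  rewrite -card_cyclic_subgroups; apply: eq_card => C; rewrite !inE.
  apply: andb_idl => sCa; rewrite (subset_trans sCa) ?(cyclicS sCa) //.
    exact: cycle_cyclic.
  exact: inverted_cycle_sub genG.
rewrite -(card_setD_inverted_cycle genG ax xx xNa).
rewrite -(card_in_imset (f := fun y => <[y]>%G)) => [|y y' Dy Dy' eq_yy'].
  apply: eq_card => C; rewrite !inE; apply/idP/imsetP=> [|[y Dy ->]].
    case/and3P=> NCa sCG /cyclicP[c def_C]; exists c; last exact: val_inj.
    move: NCa sCG; rewrite def_C !cycle_subG => cNa Gc.
    by rewrite inE cNa.
  by move: Dy; rewrite inE !cycle_subG => /andP[-> ->]; apply: cycle_cyclic.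
have: y \in <[y']> by rewrite -[<[y']>]/(val <[y']>%G) -eq_yy' cycle_id.
rewrite (cycle2g (reflection_order Dy')) !inE => /orP[] /eqP // y1.
by move: (reflection_order Dy); rewrite y1 order1.
Qed.

Lemma r1_number_dihedral_odd : odd #[a] -> r1_number G = Cyc G.
Proof.
move=> odd_a; apply: r1_number_unique_involution genG ax xx xNa _ => w wa w2.
have: #[w] %| gcdn #[a] 2.
  by rewrite dvdn_gcd order_dvdG // order_dvdn w2 eqxx.
have /eqP-> : coprime #[a] 2 by rewrite coprimen2.
by rewrite dvdn1 order_eq1 => /eqP->; apply: group1.
Qed.

(** With [z := a ^+ k], each of the [2 * k] reflections [y] generates a Klein group with [z], and
    exactly [y] and [y * z] give the same group. *)
Lemma r1_number_dihedral_even k :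
  #[a] = (2 * k)%N -> r1_number G = (Cyc G + k)%N.
Proof.
move=> oa; have k_gt0: 0 < k by move: (order_gt0 a); rewrite oa; case: (k).
pose z := a ^+ k; pose D := G :\: <[a]>; pose f y := pair_gen (y, z).
have za: z \in <[a]> by apply: mem_cycle.
have oz: #[z] = 2 by rewrite orderXdiv ?oa ?dvdn_mull // mulnK.
have z2: z ^+ 2 = 1 by rewrite -oz expg_order.
have z1: z != 1 by rewrite -order_gt1 oz.
(* A cyclic group has at most one subgroup of order 2, so [z] is the only involution of [<[a]>]. *)
have inv_a w: w \in <[a]> -> w ^+ 2 = 1 -> w != 1 -> w = z.
  move=> wa w2 w1; have ow := order2_sqr w2 w1.
  have: <[w]> == <[z]>.
    by rewrite (eq_subG_cyclic (cycle_cyclic a)) ?cycle_subG // -!orderE ow oz.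
  move/eqP/setP/(_ w); rewrite cycle_id (cycle2g oz) !inE (negbTE w1).
  by move/esym/eqP.
have sqrD y: y \in D -> y ^+ 2 = 1.
  by move=> Dy; rewrite (sqr_setD genG ax xx xNa Dy).
have comD y: y \in D -> commute y z.
  move=> Dy; apply/commute_sym/commgP/conjg_fixP.
  rewrite (conj_cycle genG ax xx xNa) //.
  by apply/eqP; rewrite eq_invg_mul -z2.
(* In a cyclic group the order-2 subgroups [<[y]>] and [<[z]>] would coincide, putting [y] into
   [<[a]>]. *)
have f_ncyc y: y \in D -> ~~ cyclic (f y).
  move=> Dy; apply: contraL (Dy) => /cyclicP[c def_f].
  have /andP[] := mem_pair_gen (y, z); rewrite -/(f y) def_f -!cycle_subG /=.
  move=> syc szc; rewrite inE negb_and negbK; apply/orP; left.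
  have /eqP e: <[y]> == <[z]>.
    by rewrite (eq_subG_cyclic (cycle_cyclic c)) // -!orderE oz reflection_order.
  have: y \in <[z]> by rewrite -e cycle_id.
  by apply/subsetP; rewrite cycle_subG.
have ncyc_f u : u \in commuting_pairs G -> ~~ cyclic (pair_gen u) ->
    exists2 y, y \in D & pair_gen u = f y.
  move=> Pu ncyc; have Nua: ~~ (pair_gen u \subset <[a]>).
    by apply: contra ncyc => /cyclicS; apply; apply: cycle_cyclic.
  have [y [w [Dy wa w2 _ gen_u]]] := commuting_pair_setD genG ax xx xNa Pu Nua.
  exists y => //; rewrite gen_u /f -(inv_a w wa w2) //.
  apply: contraNneq ncyc => w1; rewrite gen_u w1.
  exact: (pair_gen_cyclic (cycle_id y) (group1 _)).
(* Of the four elements of [f y], only [y] and [y * z] are reflections. *)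
have f_fibre y y' : y \in D -> y' \in D ->
    (f y' == f y) = (y' \in [set y; y * z]).
  move=> Dy Dy'; rewrite !inE; apply/eqP/idP=> [eq_f | ].
    have: y' \in f y by rewrite -eq_f; case/andP: (mem_pair_gen (y', z)).
    case/(klein_mem (sqrD y Dy) z2 (comD y Dy))/or4P => /eqP e; rewrite e ?eqxx ?orbT //.
      by move: Dy'; rewrite e inE group1.
    by move: Dy'; rewrite e inE za.
  case/orP=> /eqP-> //; have /andP[/= y1 y2] := mem_pair_gen (y * z, z).
  have /andP[/= y3 y4] := mem_pair_gen (y, z).
  by apply: pair_genS => //=; [rewrite groupM | rewrite -(groupMr _ y2)].
rewrite r1_numberE => [|u v Pu _ eq_uv ncyc]; last first.
  have [y Dy gen_u] := ncyc_f u Pu ncyc.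
  have sqr h : h \in pair_gen u -> h ^+ 2 = 1.
    have [y2 cyz] := (sqrD y Dy, comD y Dy).
    rewrite gen_u => /(klein_mem y2 z2 cyz)/or4P[] /eqP-> //; first exact: expg1n.
    by rewrite expgMn // y2 z2 mulg1.
  have /andP[u1 u2] := mem_pair_gen u.
  by apply: connect_klein => //; apply: sqr.
congr (_ + _)%N; rewrite (_ : [set _ | _ in _] = f @: D); last first.
  apply/setP=> C; apply/imsetP/imsetP=> [[u /setIdP[Pu ncyc] ->] | [y Dy ->]].
    by have [y Dy ->] := ncyc_f u Pu ncyc; exists y.
  exists (y, z) => //; rewrite inE (f_ncyc y Dy) andbT.
  apply/commuting_pairsP; split; last exact: comD.
    by case/setDP: Dy.
  exact: subsetP (inverted_cycle_sub genG) _ za.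
have: #|D| = (2 * k)%N by rewrite (card_setD_inverted_cycle genG ax xx xNa).
rewrite -sum1_card (partition_big_imset f) /= (eq_bigr (fun=> 2)) => [|C].
  by rewrite sum_nat_const mulnC => /eqP; rewrite eqn_pmul2l // => /eqP.
case/imsetP=> y Dy ->; rewrite sum1dep_card -[RHS]/(1.+1).
have Dyz: y * z \in D.
  move: Dy; rewrite !inE !groupMr //.
  exact: subsetP (inverted_cycle_sub genG) _ za.
have <-: #|[set y; y * z]| = 2.
  by rewrite cards2 -[X in X != _]mulg1 (inj_eq (mulgI y)) eq_sym z1.
apply: eq_card => y'; rewrite [LHS]inE; apply/andP/idP=> [[Dy' ]|].
  by rewrite f_fibre.
by move=> yy'; have Dy': y' \in D; [case/set2P: yy' => -> | rewrite f_fibre].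
Qed.

End Dihedral.

(** * The order of a presented group *)

(* The regular representation of the group with cyclic subgroup generated by u
   and flip of square s: (i, e) stands for the element i x^e. *)
Section Model.

Local Open Scope ring_scope.
Import GRing.Theory.

Variables (V : finZmodType) (u s : V).
Hypothesis ss : s + s = 0.

(** These are right multiplications, matching the left-to-right product of permutations: moving past
    [x] negates [u], and a second factor [x] contributes [s]. *)
Definition rotate_fun (p : V * bool) := (if p.2 then p.1 - u else p.1 + u, p.2).
Definition flip_fun (p : V * bool) := (if p.2 then p.1 + s else p.1, ~~ p.2).

Lemma rotate_inj : injective rotate_fun.
Proof. by case=> i [] [j []] // [] => [/addIr|/addIr] ->. Qed.

Lemma flip_inj : injective flip_fun.
Proof. by case=> i [] [j []] // [] => [/addIr|] ->. Qed.

Definition rotate_perm : {perm V * bool} := perm rotate_inj.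
Definition flip_perm : {perm V * bool} := perm flip_inj.

Lemma rotate_permX m p :
  (rotate_perm ^+ m)%g p = (if p.2 then p.1 - u *+ m else p.1 + u *+ m, p.2).
Proof.
elim: m => [|m IHm].
  by rewrite expg0 perm1 mulr0n subr0 addr0; case: p => i [].
rewrite expgSr permM {}IHm permE /rotate_fun /= mulrSr.
by case: p => i [] /=; rewrite ?opprD addrA.
Qed.

Lemma flip_perm_sqr m : s = u *+ m -> (flip_perm ^+ 2 = rotate_perm ^+ m)%g.
Proof.
move=> e_s; apply/permP=> p; rewrite expgS expg1 permM rotate_permX !permE -e_s.
(* On flipped points the power of the rotation subtracts [s], which by [ss] is its own negative. *)
by case: p => i [] //=; congr (_ + _, _); apply/eqP; rewrite -addr_eq0 ss.
Qed.

Lemma flip_rotate_perm :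
  (flip_perm * rotate_perm * flip_perm^-1 = rotate_perm^-1)%g.
Proof.
apply: (mulIg flip_perm); rewrite mulgKV; apply: (mulgI rotate_perm).
rewrite mulKVg; apply/permP=> -[i []]; rewrite !permM !permE /rotate_fun /flip_fun /=.
  by rewrite addrAC subrK.
by rewrite addrK.
Qed.

Lemma flip_perm_notin : flip_perm \notin <[rotate_perm]>%g.
Proof.
apply/cycleP=> -[m /permP/(_ (0, false))].
by rewrite rotate_permX permE.
Qed.

(** The orbit of [(0, false)] traces the multiples of [u], so the order of the rotation annihilates
    [u]. *)
Lemma order_rotate_perm N :
  (forall m, u *+ m = 0 -> N %| m) -> N %| #[rotate_perm]%g.
Proof.
move=> ou; apply: ou; have /permP/(_ (0, false)) := expg_order rotate_perm.
by rewrite rotate_permX perm1 /= add0r => -[].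
Qed.

End Model.

(* The relations bound the order of G by 2N; the permutation model, being an
   image of G, shows that this bound is reached. *)
Lemma inverted_extension (N t : nat) (gT : finGroupType) (G : {group gT}) :
    0 < N -> N %| 2 * t ->
    G \isog Grp (a : x : a ^+ N = 1, x ^+ 2 = a ^+ t, x * a * x^-1 = a^-1) ->
  exists a x, [/\ <[a]> <*> <[x]> = G, a ^ x = a^-1, x ^+ 2 = a ^+ t,
                 x \notin <[a]> & #[a] = N].
Proof.
move=> N_gt0 dv_t isoG; case: N N_gt0 => // N _ in dv_t isoG *.
have /existsP[[a x] /= /eqP[genG aN xt xax]] := isoGrp_hom isoG.
have ax: a ^ x = a^-1.
  by apply: (conjg_inj x^-1); rewrite conjgK conjVg conjgE invgK mulgA xax invgK.
have xx: x ^+ 2 \in <[a]> by rewrite xt mem_cycle.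
exists a, x; pose u : 'I_N.+1 := inZp 1; pose s := (u *+ t)%R.
have uE m : (u *+ m = inZp m)%R.
  by rewrite Zp_mulrn; apply/val_inj; rewrite /= modnMml mul1n.
have ss: (s + s = 0)%R.
  rewrite /s -GRing.mulrnDr addnn -mul2n uE; apply/val_inj/eqP; exact: dv_t.
pose r := rotate_perm u; pose f := flip_perm s.
pose H := <[r]> <*> <[f]>.
have dv_r: N.+1 %| #[r].
  by apply: order_rotate_perm => m; rewrite uE => /(congr1 val)/eqP.
(* By the universal property of the presentation, it suffices that [(r, f)] satisfies the
   relations. *)
have homH: H%G \homg G.
  rewrite isoG; apply/existsP; exists (r, f) => /=; apply/eqP.
  rewrite flip_rotate_perm // (flip_perm_sqr ss (erefl _)); congr (_, (_, _)).
  apply/permP=> p; rewrite rotate_permX uE (_ : inZp _ = 0%R); last first.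
    by apply/val_inj; rewrite /= modnn.
  by rewrite perm1 GRing.subr0 GRing.addr0; case: p => ? [].
have cardG: 2 * N.+1 <= #|G|.
  apply: leq_trans (leq_homg homH); rewrite -(Lagrange (joing_subl <[r]> <[f]>)).
  rewrite [X in X <= _]mulnC; apply: leq_mul; first exact: dvdn_leq dv_r.
  by rewrite indexg_gt1 join_subG !cycle_subG negb_and flip_perm_notin orbT.
have oa_dv: #[a] %| N.+1 by rewrite order_dvdn aN.
have oa_le: #[a] <= N.+1 by apply: dvdn_leq.
(* If [x] were in [<[a]>], then [G = <[a]>] would have at most [N.+1] elements. *)
have xNa: x \notin <[a]>.
  apply: contraTN cardG => xa; rewrite -ltnNge mul2n -addnn.
  have ->: #|G| = #[a] by rewrite -genG (joing_idPl _) // cycle_subG.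
  by rewrite addSn ltnS (leq_trans oa_le) ?leq_addl.
(* [G] is [<[a]>] together with one coset, so [2 * N.+1 <= #|G| <= 2 * #[a]]. *)
split=> //; apply/eqP; rewrite eqn_leq oa_le -leq_double -!mul2n.
apply: leq_trans cardG _; rewrite (inverted_cycleU genG ax xx).
by rewrite (leq_trans (leq_card_setU _ _)) // card_rcoset addnn -mul2n.
Qed.

(* The dihedral and dicyclic presentations *)
Local Close Scope group_scope.

Theorem theorem6 (n : nat) (n_gt0 : 0 < n) :
  (forall (gT : finGroupType) (D : {group gT}),
     (D \isog Grp (a : b : a ^+ n = b ^+ 2 = 1, b * a * b^-1 = a^-1))%g ->
     [/\ forall k : nat, n = 2 * k + 1 -> r1_number D = Cyc D,
         forall k : nat, n = 2 * k -> r1_number D = Cyc D + k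
       & Cyc D = n + tau n])
  /\
  (forall (gT : finGroupType) (Dic : {group gT}),
     (Dic \isog Grp (a : x :
        a ^+ (2 * n)%N = 1, x ^+ 2 = a ^+ n, x * a * x^-1 = a^-1))%g ->
     r1_number Dic = Cyc Dic).
Proof.
split=> gT G isoG.
  (* Taking [t = 0] makes the flip square to [a ^+ 0 = 1]; the chained relation
     [a ^+ n = b ^+ 2 = 1] is unpacked to fit this form. *)
  have [|a [b [genG ab]]] := @inverted_extension n 0 gT G n_gt0 (dvdn0 n).
    move=> rT H; rewrite isoG; apply/existsP/existsP=> -[[a b]] /=.
      by case/eqP=> <- an b2 ab; exists (a, b); rewrite /= an b2 ab eqxx.
    by case/eqP=> <- an b2 ab; exists (a, b); rewrite /= an b2 ab eqxx.
  rewrite expg0 => b2 bNa oa; split=> [k def_n|k def_n|].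
  - by apply: r1_number_dihedral_odd genG ab b2 bNa _; rewrite oa def_n oddD oddM.
  - by apply: r1_number_dihedral_even genG ab b2 bNa _ _; rewrite oa.
  by rewrite (Cyc_dihedral genG ab b2 bNa) oa.
have n2_gt0: 0 < 2 * n by rewrite muln_gt0.
have [a [x [genG ax x2 xNa oa]]] := inverted_extension n2_gt0 (dvdnn _) isoG.
have xx: (x ^+ 2 \in <[a]>)%g by rewrite x2 mem_cycle.
(* If [a ^+ i] squares to 1, then [2 * n] divides [2 * i], so [n] divides [i] and [a ^+ i] is a
   power of [a ^+ n = x ^+ 2]. *)
apply: r1_number_unique_involution genG ax xx xNa _ => _ /cycleP[i ->].
move/eqP; rewrite -expgM -order_dvdn oa (mulnC i) dvdn_pmul2l // x2.
by case/dvdnP=> j ->; rewrite mulnC expgM mem_cycle.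
Qed.
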